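(* Let $d\ge1$, $1\le n\le N\le\infty$ with $n$ finite, and let $\{\xi(i,m)\}$, $n\le i\le N$ ($i$ finite), $m=1,\dots,d$, be centered reverse martingale differences relative to one common reverse filtration $\{F(i)\}$. Put $\nu_m^{(n)}(p)=\sup_{n\le i\le N}|\xi(i,m)|_p$ and assume that, for each $m$, $\nu_m^{(n)}\in G(\nu,r_m)$ for some $2<r_m\le\infty$. Define for $p\ge2$, by reverse recursion, $$\zeta_d(p)=K_M(p)\,\nu_d^{(n)}(p),\qquad \zeta_m(p)=K_M(p)\cdot(\nu_m^{(n)}\otimes\zeta_{m+1})(p),\quad m=d-1,d-2,\dots,1.$$ Let $r=\left(\sum_{m=1}^d1/r_m\right)^{-1}$ and suppose $r>1$. Then $$\sup_{b\in B}\|V_n^{(N)}(d,b)\|G(\zeta_1)\ \le\ \prod_{m=1}^d\|\vec\xi(m)\|G(\nu_m^{(n)}),$$ where $\|V\|G(\zeta_1)=\sup_{p\in(2,r)}|V|_p/\zeta_1(p)$ and $\|\vec\xi(m)\|G(\nu_m^{(n)})=\sup_{p\in(2,r_m)}\sup_{n\le i\le N}|\xi(i,m)|_p/\nu_m^{(n)}(p)$.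
   Context: All random variables live on a probability space $(\Omega,F,\mathbf P)$; $|\xi|_p=(\mathbf E|\xi|^p)^{1/p}$; $1/\infty=0$, $1/0=\infty$. Suprema of nonnegative quantities over the empty set are $0$. Reverse martingale differences: $F(i+1)\subset F(i)\subset F$; each $\xi(i,m)$ is $F(i)$-measurable, $\mathbf E\xi(i,m)=0$, and $\mathbf E[\xi(i,m)\mid F(k)]=0$ a.s. for all $k=i+1,i+2,\dots$. The reverse filtration is the same for all $m=1,\dots,d$. $\vec\xi(m)=\{\xi(i,m)\}_i$. Polynomial: $I_n^{(N)}(d)=\{(i_1,\dots,i_d):n\le i_1<i_2<\dots<i_d\le N\}$ (finite indices); for a real non-random array $b=(b(I))$ indexed by $I_n^{(N)}(d)$, $$V_n^{(N)}(d,b)=\sum_{I=(i_1,\dots,i_d)\in I_n^{(N)}(d)}b(I)\prod_{m=1}^d\xi(i_m,m).$$ For $N=\infty$ the sum is understood as the limit as $N\to\infty$ of the sums for finite $N$, for those $b$ for which this limit exists with probability one. $B=\{b:\sum_{I\in I_n^{(N)}(d)}b^2(I)=1\}$. Class $G(\nu,r)$ ($2<r\le\infty$): functions $\nu$ that are continuous, positive and finite on $[1,r)$, with $\inf_{p\in(2,r)}\nu(p)>0$ and $\nu(p)=\infty$ for $p>r$. Operation $\otimes$: $(\nu_1\otimes\nu_2)(p)=\inf\{\nu_1(p/a)\,\nu_2(p/b):a,b>0,\ a+b=1\}$, for functions with values in $(0,\infty]$. Constant $K_M(p)$, $p\ge2$: the smallest constant $K$ such that for every finite $n$, every sequence $\theta(1),\dots,\theta(n)$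 of centered martingale differences relative to some filtration, and all real $b(1),\dots,b(n)$ with $\sum_i b^2(i)=1$, one has $\left|\sum_{i=1}^n b(i)\theta(i)\right|_p\le K\sup_i|\theta(i)|_p$. (It is known that $K_M(p)\le p\sqrt2$.) *)

(* Defs.v *)
From HB Require Import structures.
From mathcomp Require Import all_boot all_order all_algebra.
From mathcomp Require Import all_classical all_reals all_analysis.

Set Implicit Arguments.
Unset Strict Implicit.
Unset Printing Implicit Defensive.

Import Order.TTheory GRing.Theory Num.Theory.
Import numFieldNormedType.Exports.

Local Open Scope classical_set_scope.
Local Open Scope ring_scope.
Local Open Scope ereal_scope.

(* Supremum of a set of nonnegative quantities, with value 0 (not -oo) on the
   empty set. *)
Definition esup0 (R : realType) (A : set (\bar R)) : \bar R :=
  ereal_sup (0 |` A).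

Section moments.
Context (dT : measure_display) (T : measurableType dT) (R : realType).
Variable P : probability T R.

Definition Lp (p : R) (X : T -> R) : \bar R := 'N[P]_(p%:E)[EFin \o X].

Definition sub_sigma_algebra (G : set (set T)) : Prop :=
  sigma_algebra setT G /\ G `<=` measurable.

Definition measurable_wrt (G : set (set T)) (X : T -> R) : Prop :=
  forall B : set R, measurable B -> G (X @^-1` B).

(* Y is a version of the conditional expectation E[X | G]; versions are unique
   up to P-null sets, so E[X | G] = Y a.s. means is_cond_exp G X Y when Y is
   G-measurable. *)
Definition is_cond_exp (G : set (set T)) (X Y : T -> R) : Prop :=
  [/\ measurable_wrt G Y, P.-integrable setT (EFin \o Y)
    & forall A, G A -> \int[P]_(w in A) (Y w)%:E = \int[P]_(w in A) (X w)%:E].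

(* Index set {i | n <= i <= N}; N = None stands for N = oo. *)
Definition index_range (n : nat) (N : option nat) : set nat :=
  [set i | (n <= i)%N /\ if N is Some M then (i <= M)%N else True].

Definition reverse_filtration (J : set nat) (F : nat -> set (set T)) : Prop :=
  (forall i, J i -> sub_sigma_algebra (F i)) /\
  (forall i, J i -> J i.+1 -> F i.+1 `<=` F i).

Definition reverse_martingale_differences (J : set nat)
    (F : nat -> set (set T)) (xi : nat -> T -> R) : Prop :=
  forall i, J i ->
    [/\ measurable_wrt (F i) (xi i), P.-integrable setT (EFin \o xi i),
        'E_P[xi i] = 0
      & forall k, J k -> (i < k)%N -> is_cond_exp (F k) (xi i) (cst 0%R)].

Definition martingale_differences (n : nat)
    (F : 'I_n -> set (set T)) (theta : 'I_n -> T -> R) : Prop :=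
  [/\ forall i, sub_sigma_algebra (F i),
      forall i j : 'I_n, (i <= j)%N -> F i `<=` F j
    & forall i : 'I_n,
      [/\ measurable_wrt (F i) (theta i),
          P.-integrable setT (EFin \o theta i),
          'E_P[theta i] = 0
        & forall k : 'I_n, (k < i)%N ->
            is_cond_exp (F k) (theta i) (cst 0%R)]].

End moments.

(* The constant K_M depends on p only: the inequality is required on every
   probability space. *)
Definition KM_bound (R : realType) (p K : R) : Prop :=
  forall (dT : measure_display) (T : measurableType dT) (P : probability T R)
    (n : nat) (F : 'I_n -> set (set T)) (theta : 'I_n -> T -> R)
    (b : 'I_n -> R),
    martingale_differences P F theta ->
    (\sum_(i < n) b i ^+ 2 = 1)%R ->
    Lp P p (fun w => (\sum_(i < n) b i * theta i w)%R) <=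
      K%:E * esup0 [set Lp P p (theta i) | i in setT].

Definition K_M (R : realType) (p : R) : \bar R :=
  ereal_inf [set K%:E | K in KM_bound p].

Section moment_functions.
Context (R : realType).
Implicit Types (nu : R -> \bar R) (r : \bar R).

(* Moment functions are total on R; only their values on [1, +oo) matter. *)
Definition Gclass r : set (R -> \bar R) :=
  [set nu | [/\ {within [set p : R | 1 <= p%:E < r], continuous nu},
     forall p : R, 1 <= p%:E < r -> 0 < nu p < +oo,
     0 < ereal_inf [set nu p | p in [set p : R | 2%:E < p%:E < r]]
   & forall p : R, r < p%:E -> nu p = +oo]].

Definition otimes (nu1 nu2 : R -> \bar R) (p : R) : \bar R :=
  ereal_inf [set z | exists a b : R,
    [/\ (0 < a)%R, (0 < b)%R, (a + b = 1)%R
      & z = nu1 (p / a)%R * nu2 (p / b)%R]].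

(* For s = [:: nu_m; ...; nu_d] this is zeta_m; the empty list is unused. *)
Fixpoint zeta (s : seq (R -> \bar R)) : R -> \bar R :=
  match s with
  | [::] => cst 1
  | [:: nu] => fun p => K_M p * nu p
  | nu :: s' => fun p => K_M p * otimes nu (zeta s') p
  end.

End moment_functions.

Section grand_lebesgue_norms.
Context (dT : measure_display) (T : measurableType dT) (R : realType).
Variable P : probability T R.

Definition Gnorm (r : \bar R) (psi : R -> \bar R) (X : T -> R) : \bar R :=
  esup0 [set Lp P p X / psi p | p in [set p : R | 2%:E < p%:E < r]].

Definition Gnorm_seq (J : set nat) (r : \bar R) (psi : R -> \bar R)
    (X : nat -> T -> R) : \bar R :=
  esup0 [set esup0 [set Lp P p (X i) / psi p | i in J]
        | p in [set p : R | 2%:E < p%:E < r]].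

Definition moment_sup (J : set nat) (X : nat -> T -> R) (p : R) : \bar R :=
  esup0 [set Lp P p (X i) | i in J].

End grand_lebesgue_norms.

Section polynomials.
Context (dT : measure_display) (T : measurableType dT) (R : realType).
Variable P : probability T R.
Variables (d n : nat).

Definition multi_index (N : option nat) : set (d.-tuple nat) :=
  [set I : d.-tuple nat | sorted ltn I /\ forall m : 'I_d, index_range n N (tnth I m)].

(* The array b is extended arbitrarily outside multi_index N. *)
Definition V_fin (M : nat) (xi : nat -> 'I_d -> T -> R)
    (b : d.-tuple nat -> R) (w : T) : R :=
  (\sum_(I \in multi_index (Some M))
     b I * \prod_(m < d) xi (tnth I m) m w)%R.

Definition V (N : option nat) (xi : nat -> 'I_d -> T -> R)
    (b : d.-tuple nat -> R) (w : T) : R :=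
  if N is Some M then V_fin M xi b w else limn (fun M => V_fin M xi b w).

Definition V_exists (N : option nat) (xi : nat -> 'I_d -> T -> R)
    (b : d.-tuple nat -> R) : Prop :=
  if N is Some _ then True
  else {ae P, forall w, cvgn (fun M => V_fin M xi b w)}.

Definition unit_arrays (N : option nat) : set (d.-tuple nat -> R) :=
  [set b | \esum_(I in multi_index N) ((b I) ^+ 2)%:E = 1].

End polynomials.

(* Main.v *)
Require Import Defs.
From HB Require Import structures.
From mathcomp Require Import all_boot all_order all_algebra.
From mathcomp Require Import all_classical all_reals all_analysis.
From mathcomp Require Import finmap measurable_realfun zify ring lra.

Set Implicit Arguments.
Unset Strict Implicit.
Unset Printing Implicit Defensive.

Import Order.TTheory GRing.Theory Num.Theory.
Import numFieldNormedType.Exports.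

Local Open Scope classical_set_scope.
Local Open Scope ring_scope.
Local Open Scope ereal_scope.

(** Condition on the smallest index.  For a fixed first index [i], the inner sum
    over [i < i_2 < ... < i_d] is [F(i+1)]-measurable, so its product with
    [xi(i,1)] is annihilated by [E(. | F(k))] for every [k > i]: read from the
    largest index down to the smallest, the products are ordinary martingale
    differences.  Weighting them by the l^2 norms of the slices [b(i, .)] brings
    in the constant [K_M(p)], Hoelder's inequality with exponents [1/a + 1/b],
    [a + b = 1], separates the two factors and produces the operation [otimes],
    and induction on the degree bounds the inner sum.  The condition [r > 1] makes
    all products integrable.  Infinite sums follow from Fatou's lemma, and the
    right-hand side is at least [1] because [nu_m] is the supremum of the moments
    by which it is normalized. *)

(** * Moments: monotonicity, Hoelder and Minkowski inequalities *)

Section Lp_norms.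
Context (dT : measure_display) (T : measurableType dT) (R : realType).
Variable P : probability T R.
Implicit Types (p q s : R) (X Y : T -> R).

Lemma measurable_abs_powR X p : measurable_fun setT X ->
  measurable_fun setT (EFin \o (fun w => `|X w| `^ p)%R).
Proof.
move=> mX; apply/measurable_EFinP.
apply: (@measurableT_comp _ _ _ _ _ _ (@powR R ^~ p)); first exact: measurable_powR.
exact: measurableT_comp.
Qed.

Lemma Lp_ge0 p X : 0 <= Lp P p X.
Proof. exact: Lnorm_ge0. Qed.

Lemma LpE p X : Lp P p X = (\int[P]_w (`|X w| `^ p)%:E) `^ p^-1.
Proof. by rewrite /Lp unlock. Qed.

Lemma Lp0 p : p != 0%R -> Lp P p (cst 0%R) = 0.
Proof. by move=> p0; apply: Lnorm0; rewrite eqe. Qed.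

Lemma Lp_cst_lty p c : Lp P p (cst c) < +oo.
Proof.
rewrite LpE poweR_lty//= integral_cst//.
by rewrite [X in _ * X](@probability_setT _ _ _ P) mule1 ltry.
Qed.

Lemma le_Lp p X Y : (0 < p)%R -> measurable_fun setT X -> measurable_fun setT Y ->
  (forall w, `|X w| <= `|Y w|)%R -> Lp P p X <= Lp P p Y.
Proof.
move=> p0 mX mY XY; rewrite !LpE; apply: gt0_ler_poweR; first by rewrite invr_ge0 ltW.
- by rewrite in_itv/= leey andbT integral_ge0// => w _; rewrite lee_fin powR_ge0.
- by rewrite in_itv/= leey andbT integral_ge0// => w _; rewrite lee_fin powR_ge0.
apply: ge0_le_integral => //; try exact: measurable_abs_powR.
by move=> w _; rewrite lee_fin ge0_ler_powR ?nnegrE// ltW.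
Qed.

(* Hoelder's inequality for |X|^p and |Y|^p with exponents 1/a and 1/b. *)
Lemma hoelder_Lp p a b X Y : (0 < p)%R -> (0 < a)%R -> (0 < b)%R ->
  (a + b = 1)%R -> measurable_fun setT X -> measurable_fun setT Y ->
  Lp P p (X \* Y)%R <= Lp P (p / a) X * Lp P (p / b) Y.
Proof.
move=> p0 a0 b0 ab mX mY.
pose U w := (`|X w| `^ p)%R; pose V w := (`|Y w| `^ p)%R.
have mU : measurable_fun setT U by apply/measurable_EFinP/measurable_abs_powR.
have mV : measurable_fun setT V by apply/measurable_EFinP/measurable_abs_powR.
have powLp (Z : T -> R) c : (0 < c)%R ->
    Lp P c^-1 (fun w => `|Z w| `^ p)%R = Lp P (p / c) Z `^ p.
  move=> c0; rewrite (LpE (p / c)%R) -poweRrM.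
  have -> : ((p / c)^-1 * p = c)%R by rewrite invf_div divfK// gt_eqF.
  rewrite LpE invrK; apply: (congr1 (fun z => z `^ c)); apply: eq_integral => w _.
  by rewrite [X in (X `^ _)%R]ger0_norm ?powR_ge0// -powRrM.
have := @hoelder _ _ _ P U V a^-1 b^-1 mU mV.
rewrite !invr_gt0 !invrK => /(_ a0 b0 ab).
rewrite -/(Lp P a^-1 U) -/(Lp P b^-1 V) !powLp// -poweRM ?Lp_ge0// => h.
have -> : Lp P p (X \* Y)%R = 'N[P]_1[EFin \o (U \* V)%R] `^ p^-1.
  rewrite LpE Lnorm1; congr (poweR _ _); apply: eq_integral => w _.
  rewrite /= [in RHS]ger0_norm ?mulr_ge0 ?powR_ge0//.
  by rewrite normrM powRM.
have -> : Lp P (p / a) X * Lp P (p / b) Y =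
    ((Lp P (p / a) X * Lp P (p / b) Y) `^ p) `^ p^-1.
  by rewrite -poweRrM divff ?gt_eqF// poweRe1// mule_ge0// Lp_ge0.
apply: gt0_ler_poweR h; first by rewrite invr_ge0 ltW.
- by rewrite in_itv/= leey andbT; exact: Lnorm_ge0.
- by rewrite in_itv/= leey andbT poweR_ge0.
Qed.

Lemma measurable_sum_in (I : eqType) (r : seq I) (X : I -> T -> R) :
  {in r, forall i, measurable_fun setT (X i)} ->
  measurable_fun setT (fun w => \sum_(i <- r) X i w)%R.
Proof.
elim: r => [|i r IH] mX.
  by under eq_fun do rewrite big_nil; exact: measurable_cst.
under eq_fun do rewrite big_cons.
apply: measurable_funD; first by apply: mX; rewrite mem_head.
by apply: IH => j jr; apply: mX; rewrite inE jr orbT.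
Qed.

Lemma Lp_sum_le p (I : eqType) (r : seq I) (X : I -> T -> R) : (1 <= p)%R ->
  {in r, forall i, measurable_fun setT (X i)} ->
  Lp P p (fun w => \sum_(i <- r) X i w)%R <= \sum_(i <- r) Lp P p (X i).
Proof.
move=> p1; have p0 : p != 0%R by rewrite gt_eqF// (lt_le_trans ltr01).
elim: r => [|i r IH] mX.
  rewrite big_nil (_ : (fun w => _) = cst 0%R) ?Lp0//.
  by apply/funext => w; rewrite big_nil.
have mX' : {in r, forall i, measurable_fun setT (X i)}.
  by move=> j jr; apply: mX; rewrite inE jr orbT.
have -> : (fun w => \sum_(j <- i :: r) X j w)%R =
    (X i \+ (fun w => \sum_(j <- r) X j w))%R.
  by apply/funext => w; rewrite big_cons.
rewrite big_cons; apply: (le_trans (minkowski_EFin _ _ _ _)) => //.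
- by apply: mX; rewrite mem_head.
- exact: measurable_sum_in.
- by rewrite leeD2l// IH.
Qed.

Lemma Lp1_integrable X : measurable_fun setT X -> Lp P 1 X < +oo ->
  P.-integrable setT (EFin \o X).
Proof.
move=> mX X1; apply/integrableP; split; first exact/measurable_EFinP.
by move: X1; rewrite /Lp Lnorm1.
Qed.

End Lp_norms.

(** * Sub-sigma-algebras and the removal of measurable factors *)

Section sub_sigma_algebras.
Context (dT : measure_display) (T : measurableType dT) (R : realType).
Variable P : probability T R.
Implicit Types (G : set (set T)) (X Y : T -> R).

Lemma measurable_wrtP G X : sigma_algebra setT G ->
  measurable_wrt G X <-> measurable_fun setT (X : g_sigma_algebraType G -> R).
Proof.
move=> sG; split=> mX.
- move=> _ B mB; rewrite setTI measurable_g_measurableTypeE//.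
  exact: mX.
- move=> B mB; have := mX measurableT B mB.
  by rewrite setTI measurable_g_measurableTypeE.
Qed.

Lemma measurable_wrt_measurable G X : Defs.sub_sigma_algebra G ->
  measurable_wrt G X -> measurable_fun setT X.
Proof. by move=> [_ Gm] mX _ B mB; rewrite setTI; exact/Gm/mX. Qed.

Lemma measurable_wrt_cst G (c : R) : Defs.sub_sigma_algebra G -> measurable_wrt G (cst c : T -> R).
Proof. by move=> [sG _]; apply/measurable_wrtP => //; exact: measurable_cst. Qed.

Lemma measurable_wrtM G X Y : Defs.sub_sigma_algebra G ->
  measurable_wrt G X -> measurable_wrt G Y -> measurable_wrt G (X \* Y)%R.
Proof.
move=> [sG _] /(measurable_wrtP _ sG) mX /(measurable_wrtP _ sG) mY.
by apply/measurable_wrtP => //; exact: measurable_funM.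
Qed.

Lemma measurable_wrt_sum G (I : eqType) (r : seq I) (X : I -> T -> R) :
  Defs.sub_sigma_algebra G -> {in r, forall i, measurable_wrt G (X i)} ->
  measurable_wrt G (fun w => \sum_(i <- r) X i w)%R.
Proof.
move=> [sG _] mX; apply/measurable_wrtP => //.
apply: (@measurable_sum_in _ (g_sigma_algebraType G)) => i ir.
by apply/measurable_wrtP => //; exact: mX.
Qed.

Lemma measurable_wrt_indic G A : Defs.sub_sigma_algebra G -> G A ->
  measurable_wrt G (\1_A : T -> R).
Proof.
move=> [sG _] GA; apply/measurable_wrtP => //.
by apply: measurable_indic; rewrite measurable_g_measurableTypeE.
Qed.

Import HBNNSimple.

(** Simple functions increasing to [Y] reduce the claim to the integrals of [X] over sets of [G],
    which vanish. Dominated convergence with bound [|X Y|] passes to the limit. *)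
Lemma integral_mul_ge0_eq0 G X Y : Defs.sub_sigma_algebra G ->
  P.-integrable setT (EFin \o X) ->
  (forall A, G A -> \int[P]_(w in A) (X w)%:E = 0) ->
  measurable_wrt G Y -> (forall w, 0 <= Y w)%R ->
  P.-integrable setT (EFin \o (X \* Y)%R) ->
  \int[P]_w (X w * Y w)%:E = 0.
Proof.
move=> sG iX X0 mY Y0 iXY; have [sGs Gm] := sG.
(* Approximating [Y] on the space that carries [G] as its sigma-algebra puts the level sets of every
   [h n] into [G]. *)
pose T' := g_sigma_algebraType G.
have mT' : @measurable _ T' setT by exact: measurableT.
have mEY : measurable_fun (setT : set T') (EFin \o Y).
  by apply/measurable_EFinP; apply/measurable_wrtP.
pose h := nnsfun_approx mT' mEY.
have GA n y : G (h n @^-1` [set y]).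
  have := measurable_sfunP (h n) (measurable_set1 y).
  by rewrite measurable_g_measurableTypeE.
pose f n w := ((X w * h n w)%:E : \bar R).
have fE n w : f n w = \sum_(y <- fset_set (range (h n)))
    (y%:E * ((EFin \o X) \_ (h n @^-1` [set y])) w).
  rewrite /f fimfunE fsbig_finite//= big_distrr/= -sumEFin.
  apply: eq_bigr => y _; rewrite patchE indicE.
  by case: ifPn => _; rewrite ?mulr1 ?mulr0 ?mule0// -EFinM mulrC.
have iXA n y : P.-integrable setT ((EFin \o X) \_ (h n @^-1` [set y])).
  have mA : measurable (h n @^-1` [set y] : set T) := Gm _ (GA n y).
  apply/(@integrable_mkcond _ T _ P _ (EFin \o X) mA).
  exact: (integrableS measurableT mA (@subsetT _ _) iX).
have If n : \int[P]_w f n w = 0.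
  under eq_integral do rewrite fE.
  rewrite integral_sum//; last by move=> y; exact: integrableZl.
  rewrite big1// => y _; rewrite integralZl//.
  by rewrite -integral_mkcond X0 ?mule0//; exact: GA.
have mf n : measurable_fun setT (f n).
  apply/measurable_int/(_ : P.-integrable setT (f n)).
  rewrite (_ : f n = fun w => \sum_(y <- fset_set (range (h n)))
    (y%:E * ((EFin \o X) \_ (h n @^-1` [set y])) w)); last exact/funext.
  by apply: integrable_sum => // y _; exact: integrableZl.
have cvh w : (fun n => h n w) @ \oo --> Y w.
  have := @cvg_nnsfun_approx _ T' R setT mT' _ mEY (fun x _ => Y0 x) w I.
  by move=> /fine_cvg.
have hY n w : (h n w <= Y w)%R.
  have nd : nondecreasing_seq (fun n => h n w).
    by move=> a b ab; exact/lefP/nd_nnsfun_approx.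
  rewrite -(cvg_lim _ (cvh w))//; apply: nondecreasing_cvgn_le => //.
  by apply/cvg_ex; exists (Y w); exact: cvh.
have [] := @dominated_convergence _ _ _ P setT measurableT f
  (EFin \o (X \* Y)%R) (abse \o (EFin \o (X \* Y)%R)).
- exact: mf.
- exact: measurable_int iXY.
- by apply: aeW => w _; apply: cvg_EFin; [exact: nearW|exact: cvgM (cvg_cst _) (cvh w)].
- exact: integrable_abse.
- apply: aeW => w n _; rewrite /f/= lee_fin !normrM ler_wpM2l//.
  by rewrite !ger0_norm.
move=> _ _; under eq_fun do rewrite If.
by move=> /(cvg_unique _ (cvg_cst 0)) <-.
Qed.

(** The indicator of [A] is absorbed into [Z], and [Z = (|Z| + Z) - |Z|] is a difference of
    nonnegative [G]-measurable functions whose products with [X] are integrable, so the nonnegative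
    case applies twice. *)
Lemma integral_mul_eq0 G X Y : Defs.sub_sigma_algebra G ->
  P.-integrable setT (EFin \o X) ->
  (forall A, G A -> \int[P]_(w in A) (X w)%:E = 0) ->
  measurable_wrt G Y -> P.-integrable setT (EFin \o (X \* Y)%R) ->
  forall A, G A -> \int[P]_(w in A) (X w * Y w)%:E = 0.
Proof.
move=> sG iX X0 mY iXY A GA; have [sGs Gm] := sG.
pose Z := (Y \* \1_A)%R.
have mZ : measurable_wrt G Z.
  by apply: measurable_wrtM => //; exact: measurable_wrt_indic.
have mX : measurable_fun setT X by exact/measurable_EFinP/(measurable_int _ iX).
have mZ' : measurable_fun setT Z by exact: measurable_wrt_measurable mZ.
have iXZ : P.-integrable setT (EFin \o (X \* Z)%R).
  apply: le_integrable iXY => //.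
    exact/measurable_EFinP/measurable_funM.
  move=> w _; rewrite /= lee_fin /Z /= mulrA normrM ler_piMr// indicE.
  by case: (_ \in _); rewrite ?normr0 ?normr1.
have mN : measurable_wrt G (fun w => `|Z w|)%R.
  apply/measurable_wrtP => //; apply: measurableT_comp => //.
  exact/measurable_wrtP.
have iN : P.-integrable setT (EFin \o (X \* (fun w => `|Z w|))%R).
  apply: le_integrable iXZ => //.
    by apply/measurable_EFinP/measurable_funM => //; exact: measurableT_comp.
  by move=> w _; rewrite /= lee_fin !normrM !normr_id.
have mU : measurable_wrt G (fun w => `|Z w| + Z w)%R.
  apply/measurable_wrtP => //.
  by apply: measurable_funD; exact/measurable_wrtP.
have EU : EFin \o (X \* (fun w => `|Z w| + Z w))%R =
    (EFin \o (X \* (fun w => `|Z w|))%R) \+ (EFin \o (X \* Z)%R).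
  by apply/funext => w /=; rewrite mulrDr EFinD.
have iU : P.-integrable setT (EFin \o (X \* (fun w => `|Z w| + Z w))%R).
  by rewrite EU; exact: integrableD.
have IU : \int[P]_w (X w * (`|Z w| + Z w))%:E = 0.
  apply: (integral_mul_ge0_eq0 sG iX X0 mU _ iU) => w.
  by have := ler_norm (- Z w); rewrite normrN -subr_ge0 opprK.
have IN : \int[P]_w (X w * `|Z w|)%:E = 0.
  exact: (integral_mul_ge0_eq0 sG iX X0 mN _ iN).
have : \int[P]_w (X w * Z w)%:E = 0.
  by move: IU; rewrite (_ : (fun w => _) = (EFin \o (X \* (fun w => `|Z w|))%R)
    \+ (EFin \o (X \* Z)%R))// integralD// IN add0e.
move=> <-; rewrite integral_mkcond; apply: eq_integral => w _.
by rewrite patchE /Z /= indicE; case: ifPn => _; rewrite ?mulr1 ?mulr0.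
Qed.

End sub_sigma_algebras.

(** * Suprema of nonnegative quantities and lower bounds for [K_M] *)

Section esup0.
Context (R : realType).
Implicit Types (A : set (\bar R)) (x : \bar R).

Lemma esup0_ge0 A : 0 <= esup0 A.
Proof. by apply: ereal_sup_ubound; left. Qed.

Lemma esup0_ubound A x : A x -> x <= esup0 A.
Proof. by move=> Ax; apply: ereal_sup_ubound; right. Qed.

Lemma esup0_le A x : 0 <= x -> (forall y, A y -> y <= x) -> esup0 A <= x.
Proof. by move=> x0 Ax; apply: ge_ereal_sup => y [->|/Ax]. Qed.

End esup0.

(* Test the bound on a single Rademacher variable. *)
Lemma KM_bound_ge1 (R : realType) (p K : R) : (0 < p)%R -> KM_bound p K -> (1 <= K)%R.
Proof.
move=> p0 hK; have pn0 : p != 0%R by rewrite gt_eqF.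
pose P : probability bool R := bernoulli_prob (2^-1 : R).
have h01 : (0 <= (2^-1 : R) <= 1)%R by rewrite invr_ge0 ler0n/= invf_le1 ?ler1n.
pose th (i : 'I_1) (x : bool) : R := if x then 1%R else (-1)%R.
pose F (i : 'I_1) : set (set bool) := measurable.
have mth i : measurable_fun setT (th i) by [].
have ith i : P.-integrable setT (EFin \o th i).
  apply: measurable_bounded_integrable => //.
    by apply: (@le_lt_trans _ _ 1); [exact: probability_le1|exact: ltry].
  exists 1%R; split => // x x1 [] _ /=; rewrite ?normrN normr1; exact: ltW.
have Eth i : \int[P]_x (th i x)%:E = 0.
  (* The Bernoulli integral formula concerns nonnegative integrands, so [th i] is integrated as
     [f1 - 1]. *)
  pose f1 (x : bool) : R := if x then 2%R else 0%R.
  have if1 : P.-integrable setT (EFin \o f1).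
    apply: measurable_bounded_integrable => //.
      by apply: (@le_lt_trans _ _ 1); [exact: probability_le1|exact: ltry].
    exists 2%R; split => // x x1 [] _ /=; first by rewrite ger0_norm// ltW.
    by rewrite normr0 (le_trans _ (ltW x1)).
  have i1 : P.-integrable setT (EFin \o cst 1%R : bool -> \bar R).
    exact: finite_measure_integrable_cst.
  rewrite (_ : (fun x => _) = (EFin \o (f1 \- cst 1)%R)); last first.
    by apply/funext => -[] /=; congr EFin; rewrite /f1 /th; lra.
  rewrite integralB_EFin//.
  rewrite /P !integral_bernoulli_prob//=.
    by rewrite mule0 adde0 -EFinM -EFinD; congr EFin; rewrite /unstable.onem; field.
  by move=> []; rewrite lee_fin.
have Lth i : Lp P p (th i) = 1.
  rewrite LpE (_ : (fun w => _) = cst 1%E); last first.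
    by apply/funext => -[] /=; rewrite /th ?normrN normr1 powR1.
  by rewrite integral_cst// mul1e [X in X `^ _](@probability_setT _ _ _ P) poweR1r.
have := hK _ bool P 1%N F th (fun=> 1%R).
rewrite big_ord1 expr1n => /(_ _ erefl).
have -> : (fun w => \sum_(i < 1) 1 * th i w)%R = th ord0.
  by apply/funext => w; rewrite big_ord1 mul1r.
rewrite Lth.
rewrite [X in _ * X](_ : _ = 1); last first.
  apply/eqP; rewrite eq_le; apply/andP; split.
    by apply: esup0_le => // _ [i _ <-].
  by apply: esup0_ubound; exists ord0.
rewrite mule1 lee_fin; apply.
split=> // i; split => //.
- by rewrite unlock.
- by move=> k; rewrite !ord1.
Qed.

Lemma K_M_gt0 (R : realType) (p : R) : (0 < p)%R -> 0 < K_M p.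
Proof.
move=> p0; apply: (@lt_le_trans _ _ 1) => //.
by apply: le_ereal_inf_tmp => _ [K hK <-]; rewrite lee_fin (KM_bound_ge1 p0 hK).
Qed.

(** * The defining inequality of [K_M] *)

Section martingale_transform.
Context (dT : measure_display) (T : measurableType dT) (R : realType).
Variable P : probability T R.

(** The inequality holds for every admissible [K] and passes to the infimum after division by [B].
    This requires [B] positive and finite, so [B = 0] and [B = +oo] are settled apart. *)
Lemma martingale_Lp_le (p : R) (n : nat) (F : 'I_n -> set (set T))
    (theta : 'I_n -> T -> R) (b : 'I_n -> R) (B : \bar R) :
  (1 <= p)%R -> martingale_differences P F theta ->
  (\sum_(i < n) b i ^+ 2 = 1)%R -> 0 <= B ->
  (forall i, Lp P p (theta i) <= B) ->
  Lp P p (fun w => \sum_(i < n) b i * theta i w)%R <= K_M p * B.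
Proof.
move=> p1 md b1 B0 thB; have p0 : (0 < p)%R by rewrite (lt_le_trans ltr01).
have mth i : measurable_fun setT (theta i).
  have [sF _ /(_ i)[_ ith _ _]] := md.
  exact/measurable_EFinP/(measurable_int _ ith).
have hK K : KM_bound p K ->
    Lp P p (fun w => \sum_(i < n) b i * theta i w)%R <= K%:E * B.
  move=> hK; apply: (le_trans (hK _ _ _ _ _ _ _ md b1)).
  apply: lee_wpmul2l.
    by rewrite lee_fin (le_trans ler01)// (KM_bound_ge1 p0 hK).
  by apply: esup0_le => // _ [i _ <-].
(* For [B = 0] all [theta i] have norm zero and Minkowski annihilates the sum; the right-hand side
   is [0] even if [K_M p = +oo]. *)
have [B00|Bn0] := eqVneq B 0.
  rewrite B00 mule0.
  apply: (le_trans (Lp_sum_le _ _ _)) => //.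
    by move=> i _; exact: measurable_funM.
  rewrite big1// => i _; apply/eqP; rewrite eq_le Lp_ge0 andbT -[leRHS]B00.
  apply: le_trans (thB i); apply: le_Lp => //; first exact: measurable_funM.
  move=> w; rewrite normrM ler_piMl// -(@expr_le1 _ 2)// real_normK ?num_real//.
  by rewrite -b1 (bigD1 i)//= lerDl sumr_ge0// => j _; rewrite sqr_ge0.
case: B B0 Bn0 thB hK => [B| |//] B0 Bn0 thB hK; last by rewrite gt0_muley ?leey// K_M_gt0.
have {}B0 : (0 < B)%R by rewrite -lte_fin lt0e Bn0.
rewrite -lee_pdivrMr//; apply: le_ereal_inf_tmp => _ [K /hK hK' <-].
by rewrite lee_pdivrMr.
Qed.

End martingale_transform.

(** * Ranges of finite moments under products and sums *)

Section moment_bounds.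
Context (dT : measure_display) (T : measurableType dT) (R : realType).
Variable P : probability T R.
Implicit Types (s q : R) (X Y : T -> R).

(* All moments of order below 1/s are finite; s = 0 encodes all orders. *)
Definition moments_below s X :=
  measurable_fun setT X /\
  forall q, (1 <= q)%R -> (q * s < 1)%R -> Lp P q X < +oo.

Lemma moments_below_cst s (c : R) : moments_below s (cst c).
Proof. by split=> [|q _ _]; [exact: measurable_cst|exact: Lp_cst_lty]. Qed.

Lemma moments_belowM s1 s2 X Y : (0 <= s1)%R -> (0 <= s2)%R ->
  moments_below s1 X -> moments_below s2 Y -> moments_below (s1 + s2) (X \* Y)%R.
Proof.
move=> s10 s20 [mX hX] [mY hY]; split=> [|q q1 qs]; first exact: measurable_funM.
have q0 : (0 < q)%R by rewrite (lt_le_trans ltr01).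
(* Half of the slack in [q * (s1 + s2) < 1] goes to each Hoelder weight: the weights then sum to
   one, are positive even when [s1] or [s2] is zero, and leave both orders strictly inside their
   ranges. *)
pose e := ((1 - q * (s1 + s2)) / 2)%R.
have e0 : (0 < e)%R by rewrite divr_gt0// subr_gt0.
have qs1 : (0 <= q * s1)%R by rewrite mulr_ge0// ltW.
have qs2 : (0 <= q * s2)%R by rewrite mulr_ge0// ltW.
have a0 : (0 < q * s1 + e)%R by rewrite ltr_wpDl.
have b0 : (0 < q * s2 + e)%R by rewrite ltr_wpDl.
have ab : ((q * s1 + e) + (q * s2 + e) = 1)%R by rewrite /e; field.
apply: (le_lt_trans (hoelder_Lp _ q0 a0 b0 ab mX mY)).
rewrite lte_mul_pinfty ?Lp_ge0//.
- rewrite ge0_fin_numE ?Lp_ge0//; apply: hX.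
    by rewrite ler_pdivlMr// mul1r; lra.
  by rewrite mulrAC ltr_pdivrMr// mul1r; lra.
- apply: hY; first by rewrite ler_pdivlMr// mul1r; lra.
  by rewrite mulrAC ltr_pdivrMr// mul1r; lra.
Qed.

Lemma moments_below_sum s (I : eqType) (r : seq I) (X : I -> T -> R) :
  {in r, forall i, moments_below s (X i)} ->
  moments_below s (fun w => \sum_(i <- r) X i w)%R.
Proof.
move=> hX; split=> [|q q1 qs].
  by apply: measurable_sum_in => i /hX[].
apply: (@le_lt_trans _ _ (\sum_(i <- r) Lp P q (X i))).
  by apply: Lp_sum_le => // i /hX[].
rewrite big_seq; apply: lte_sum_pinfty => i /hX[_]; exact.
Qed.

Lemma moments_below_integrable s X : (s < 1)%R -> moments_below s X ->
  P.-integrable setT (EFin \o X).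
Proof. by move=> s1 [mX hX]; apply: Lp1_integrable => //; apply: hX; rewrite ?mul1r. Qed.

End moment_bounds.

(** * Nested sums over increasing indices *)

Section iterated_sums.
Context (R : realType) (M : nat).
Implicit Types (k d : nat) (b : seq nat -> R).

(** The squared l^2 norm of [b] over increasing lists of length [d] in [{k, ..., M}], nested so that
    a slice at a fixed first index is again of this form. *)
Fixpoint sqsum k d b : R :=
  if d is d'.+1 then \sum_(k <= i < M.+1) sqsum i.+1 d' (b \o cons i)
  else b [::] ^+ 2.

Lemma sqsum_ge0 k d b : (0 <= sqsum k d b)%R.
Proof.
by elim: d k b => [|d IH] k b /=; [exact: sqr_ge0|exact: sumr_ge0].
Qed.

Lemma sqsumZ k d b (a : R) :
  sqsum k d (fun s => b s * a)%R = (sqsum k d b * a ^+ 2)%R.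
Proof.
elim: d k b => [|d IH] k b /=; first by rewrite exprMn.
by rewrite mulr_suml; apply: eq_bigr => i _; rewrite -IH.
Qed.

Context (T I : Type) (X : I -> nat -> T -> R).
Implicit Types l : seq I.

(** The polynomial with the smallest index outermost. The list [l] names the factors in order, so
    induction on the degree is induction on [l]. *)
Fixpoint iter_poly k l b (w : T) : R :=
  if l is m :: l' then
    (\sum_(k <= i < M.+1) X m i w * iter_poly i.+1 l' (b \o cons i) w)%R
  else b [::].

Lemma iter_polyZ k l b (a : R) w :
  iter_poly k l (fun s => b s * a)%R w = (iter_poly k l b w * a)%R.
Proof.
elim: l k b => [//|m l IH] k b /=.
by rewrite mulr_suml; apply: eq_bigr => i _; rewrite -mulrA -IH.
Qed.

Lemma iter_poly_eq0 k l b w : sqsum k (size l) b = 0%R -> iter_poly k l b w = 0%R.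
Proof.
elim: l k b => [|m l IH] k b /=.
  by move/eqP; rewrite sqrf_eq0 => /eqP.
move/eqP; rewrite psumr_eq0 => [/allP h|i _]; last exact: sqsum_ge0.
rewrite big_seq big1// => i ik; rewrite IH ?mulr0//.
by apply/eqP/h.
Qed.

End iterated_sums.

(** The substitution [i = M - j] lists the indices from the largest down. For [k > M] truncated
    subtraction leaves both sums empty. *)
Lemma sum_nat_sub (R : nmodType) (k M : nat) (f : nat -> R) :
  (\sum_(k <= i < M.+1) f i = \sum_(j < M.+1 - k) f (M - j)%N)%R.
Proof.
have [Mk|kM] := leqP M.+1 k.
  by rewrite big_geq//; move: Mk; rewrite -subn_eq0 => /eqP ->; rewrite big_ord0.
rewrite big_nat_rev/= -{1}(add0n k) big_addn big_mkord.
by apply: eq_bigr => j _; congr f; lia.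
Qed.


(** * Induction on the degree by conditioning on the smallest index *)

Section decoupling.
Context (dT : measure_display) (T : measurableType dT) (R : realType).
Variable P : probability T R.
Context (I : Type) (X : I -> nat -> T -> R) (n M : nat) (G : nat -> set (set T)).
Hypothesis sigmaG : forall k, (n <= k)%N -> Defs.sub_sigma_algebra (G k).
Hypothesis decrG : forall k, (n <= k)%N -> G k.+1 `<=` G k.
Hypothesis measX : forall m i, (n <= i <= M)%N -> measurable_wrt (G i) (X m i).
Hypothesis X0 : forall m i k A, (n <= i <= M)%N -> (i < k)%N -> G k A ->
  \int[P]_(w in A) (X m i w)%:E = 0.
Variable s : I -> R.
Hypothesis s_ge0 : forall m, (0 <= s m)%R.
Hypothesis momX : forall m i, (n <= i <= M)%N -> moments_below P (s m) (X m i).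
Variable nu : I -> R -> \bar R.
Hypothesis nuX : forall m i p, (n <= i <= M)%N -> Lp P p (X m i) <= nu m p.
Hypothesis nu_ge0 : forall m p, 0 <= nu m p.
Implicit Types (k : nat) (l : seq I) (b : seq nat -> R) (p : R).

Lemma decrG_le k k' : (n <= k)%N -> (k <= k')%N -> G k' `<=` G k.
Proof.
move=> nk /subnK <-; elim: (k' - k)%N => [//|j IH]; rewrite addSn.
apply: subset_trans IH; apply: decrG.
by rewrite (leq_trans nk)// leq_addl.
Qed.

(** Every factor carries an index [i >= k], and [G] decreases, so all of them are measurable for the
    largest sigma-algebra [G k]. *)
Lemma iter_poly_measurable k l b : (n <= k)%N -> measurable_wrt (G k) (iter_poly M X k l b).
Proof.
elim: l k b => [|m l IH] k b nk.
  by apply: measurable_wrt_cst; exact: sigmaG.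
apply: measurable_wrt_sum; first exact: sigmaG.
move=> i; rewrite mem_index_iota => /andP[ki iM].
have ni := leq_trans nk ki.
apply: measurable_wrtM; first exact: sigmaG.
- move=> B mB; apply: (decrG_le nk ki).
  by apply: measX => //; rewrite ni.
- move=> B mB; apply: (decrG_le nk (leqW ki)).
  by apply: IH => //; exact: leqW.
Qed.

(** With [s m] in the role of [1 / r_m], Hoelder adds these reciprocals along the factors of a
    product, and Minkowski handles the sums. *)
Lemma iter_poly_moments k l b : (n <= k)%N ->
  moments_below P (\sum_(m <- l) s m)%R (iter_poly M X k l b).
Proof.
elim: l k b => [|m l IH] k b nk; first exact: moments_below_cst.
apply: moments_below_sum => i; rewrite mem_index_iota => /andP[ki iM].
have ni := leq_trans nk ki.
rewrite big_cons; apply: moments_belowM => //.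
- exact: sumr_ge0.
- by apply: momX; rewrite ni.
- by apply: IH; exact: leqW.
Qed.

Lemma zeta_ge0 l p : (0 < p)%R -> 0 <= zeta [seq nu m | m <- l] p.
Proof.
elim: l p => [//|m [|m' l] IH] p p0.
  by apply: mule_ge0 => //; exact/ltW/K_M_gt0.
apply: mule_ge0; first exact/ltW/K_M_gt0.
apply: le_ereal_inf_tmp => _ [a [b [a0 b0 _ ->]]].
by apply: mule_ge0 => //; apply: IH; rewrite divr_gt0.
Qed.

(* Enumerating the indices downwards turns reverse into ordinary differences. *)
Lemma iter_poly_terms_martingale k m l (b : nat -> seq nat -> R) : (n <= k)%N ->
  (\sum_(m <- m :: l) s m < 1)%R ->
  martingale_differences P (fun j : 'I_(M.+1 - k) => G (M - j)%N)
    (fun j w => X m (M - j)%N w * iter_poly M X (M - j).+1 l (b (M - j)%N) w)%R.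
Proof.
move=> nk sl1.
have rng (j : 'I_(M.+1 - k)) : (n <= M - j <= M)%N.
  rewrite leq_subr andbT (leq_trans nk)//.
  by have := ltn_ord j; lia.
have nj j := proj1 (andP (rng j)).
have iXW (j : 'I_(M.+1 - k)) : P.-integrable setT (EFin \o
    (X m (M - j)%N \* iter_poly M X (M - j).+1 l (b (M - j)%N))%R).
  apply: (moments_below_integrable sl1); rewrite big_cons.
  apply: moments_belowM => //; first exact: sumr_ge0.
    exact: momX.
  by apply: iter_poly_moments; exact: leqW.
have iX (j : 'I_(M.+1 - k)) : P.-integrable setT (EFin \o X m (M - j)%N).
  apply: (@moments_below_integrable _ _ _ _ (s m)); last exact: momX.
  by apply: le_lt_trans sl1; rewrite big_cons lerDl; exact: sumr_ge0.
have XW0 (j : 'I_(M.+1 - k)) A : G (M - j).+1 A ->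
    \int[P]_(w in A) (X m (M - j)%N w * iter_poly M X (M - j).+1 l (b (M - j)%N) w)%:E = 0.
  apply: integral_mul_eq0.
  - by apply: sigmaG; exact: leqW.
  - exact: iX.
  - by move=> B; apply: X0.
  - by apply: iter_poly_measurable; exact: leqW.
  - exact: iXW.
have GT k' : (n <= k')%N -> G k' setT.
  move=> /sigmaG[[G0 GC _] _]; rewrite -(setD0 setT); exact: GC.
split.
- by move=> j; exact: sigmaG.
- by move=> i j ij; apply: decrG_le => //; exact: leq_sub2l.
- move=> i; split.
  + apply: measurable_wrtM; [exact: sigmaG|exact: measX|].
    move=> B mB; apply: decrG => //.
    by apply: iter_poly_measurable => //; exact: leqW.
  + exact: iXW.
  + by rewrite unlock; apply: XW0; apply: GT; exact: leqW.
  + move=> j ji; split.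
    * by apply: measurable_wrt_cst; exact: sigmaG.
    * exact: finite_measure_integrable_cst.
    (* For [j < i] one has [M - j >= (M - i).+1], so [G (M - j)] lies in [G (M - i).+1], on which
       the integrals already vanish. *)
    * move=> A GA; rewrite XW0; first by rewrite integral0.
      apply: decrG_le GA; first exact: leqW.
      by have := ltn_ord i; lia.
Qed.

(** The outer sum is a martingale sum and costs a factor [K_M p]; its coefficients are the relative
    norms of the slices, and the normalized slices feed the induction. Assuming [<= 1] instead of
    [= 1] admits null slices. *)
Lemma iter_poly_Lp_le k l b p : (n <= k)%N -> (0 < size l)%N ->
  (\sum_(m <- l) s m < 1)%R -> (sqsum M k (size l) b <= 1)%R -> (1 <= p)%R ->
  Lp P p (iter_poly M X k l b) <= zeta [seq nu m | m <- l] p.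
Proof.
elim: l k b p => [//|m l IH] k b p nk _ sl1 b1 p1.
have p0 : (0 < p)%R by rewrite (lt_le_trans ltr01).
(* A null array cannot be normalized, but its polynomial is zero. *)
have [C0|C0] := eqVneq (sqsum M k (size (m :: l)) b) 0%R.
  rewrite (_ : iter_poly _ _ _ _ _ = cst 0%R); last first.
    by apply/funext => w; exact: iter_poly_eq0.
  by rewrite Lp0 ?gt_eqF// zeta_ge0.
set C := sqsum M k _ b in C0 b1.
have Cgt0 : (0 < C)%R by rewrite lt0r C0 sqsum_ge0.
pose c i := sqsum M i.+1 (size l) (b \o cons i).
have c0 i : (0 <= c i)%R by exact: sqsum_ge0.
(* If a i = 0, the slice b (i :: _) vanishes, and so does b' i as 0^-1 = 0. *)
pose a i := Num.sqrt (c i / C).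
have a2 i : (a i ^+ 2 = c i / C)%R by rewrite sqr_sqrtr// divr_ge0// ltW.
pose b' i t := (b (i :: t) * (a i)^-1)%R.
have b'E i : b' i = (fun t => (b \o cons i) t * (a i)^-1)%R by [].
pose theta i w := (X m i w * iter_poly M X i.+1 l (b' i) w)%R.
have b'1 i : (sqsum M i.+1 (size l) (b' i) <= 1)%R.
  rewrite b'E sqsumZ -/(c i).
  have [->|ci] := eqVneq (c i) 0%R; first by rewrite mul0r.
  by rewrite exprVn a2 invf_div mulrCA divff// mulr1.
have -> : iter_poly M X k (m :: l) b =
    (fun w => \sum_(j < M.+1 - k) a (M - j)%N * theta (M - j)%N w)%R.
  apply/funext => w /=; rewrite sum_nat_sub; apply: eq_bigr => j _.
  set i := (M - j)%N; rewrite /theta mulrCA; congr (_ * _)%R.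
  rewrite b'E iter_polyZ.
  have [ai|ai] := eqVneq (a i) 0%R; last by rewrite mulrCA divff// mulr1.
  rewrite ai mul0r iter_poly_eq0//; move: (a2 i).
  by rewrite ai expr0n/= => /esym/eqP; rewrite mulf_eq0 invr_eq0 (negbTE C0) orbF => /eqP.
have md := @iter_poly_terms_martingale k m l b' nk sl1.
have a1 : (\sum_(j < M.+1 - k) a (M - j)%N ^+ 2 = 1)%R.
  rewrite -(sum_nat_sub k M (fun i => a i ^+ 2)%R).
  under eq_bigr do rewrite a2.
  by rewrite -mulr_suml divff.
have rng (j : 'I_(M.+1 - k)) : (n <= M - j <= M)%N.
  rewrite leq_subr andbT (leq_trans nk)//.
  by have := ltn_ord j; lia.
have mX i : (n <= i <= M)%N -> measurable_fun setT (X m i) by move=> /(momX m)[].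
have mW i : (n <= i <= M)%N -> measurable_fun setT (iter_poly M X i.+1 l (b' i)).
  by move=> /andP[ni _]; have [] := @iter_poly_moments i.+1 l (b' i) (leqW ni).
clear b'E; case: l IH sl1 @C C0 b1 Cgt0 @c c0 @a a2 @b' @theta b'1 md a1 mW => [|m' l] IH sl1 C C0 b1 Cgt0 c c0 a a2 b' theta b'1 md a1 mW.
  (* Degree one: the inner factor is the constant [b' i [::]], of modulus at most one. *)
  apply: (martingale_Lp_le p1 md a1) => // j.
  apply: le_trans (nuX m p (rng j)); apply: le_Lp => //.
  - by apply: measurable_funM; [exact: mX|exact: mW].
  - exact: mX.
  - move=> w /=; rewrite normrM ler_piMr// -(@expr_le1 _ 2)// real_normK ?num_real//.
    exact: b'1.
apply: (martingale_Lp_le p1 md a1).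
  apply: le_ereal_inf_tmp => _ [x [y [x0 y0 _ ->]]].
  by apply: mule_ge0 => //; apply: (@zeta_ge0 (m' :: l)); rewrite divr_gt0.
(* The value of [otimes] is an infimum, so Hoelder is applied to each splitting [x + y = 1]. The
   inner factor is bounded at order [p / y], which is at least [1] because [y < 1]. *)
move=> j; apply: le_ereal_inf_tmp => _ [x [y [x0 y0 xy ->]]].
apply: (le_trans (hoelder_Lp _ p0 x0 y0 xy _ _)).
- exact: mX.
- exact: mW.
apply: lee_pmul; rewrite ?Lp_ge0//; first exact: nuX.
apply: IH => //.
- by rewrite leqW//; case/andP: (rng j).
- by apply: le_lt_trans sl1; rewrite [leRHS]big_cons lerDr.
- by rewrite ler_pdivlMr// mul1r (le_trans _ p1)//; lra.
Qed.

End decoupling.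

(** * Measurability of limits and Fatou's lemma for moments *)

Section limits.
Context (dT : measure_display) (T : measurableType dT) (R : realType).
Implicit Types (f : nat -> T -> R).

Lemma measurable_fun_limn_einf (D : set T) (f : nat -> T -> \bar R) :
  (forall k, measurable_fun D (f k)) ->
  measurable_fun D (fun w => limn_einf (f ^~ w)).
Proof.
move=> mf; rewrite (_ : (fun w => _) =
    (fun w => - limn_esup (fun k => - f k w))); last first.
  by apply/funext => w; rewrite -limn_einfN; congr limn_einf; apply/funext => k /=; rewrite oppeK.
apply: measurableT_comp => //; apply: measurable_fun_limn_esup => k.
exact: measurableT_comp.
Qed.

(** Lower and upper limits are measurable in the sample point, so this criterion makes the set of
    convergence measurable. Conversely, the sequence is squeezed between [einfs] and [esups]. *)
Lemma cvgn_limn_einf_esup (u : nat -> R) : cvgn u <->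
  limn_einf (EFin \o u) = limn_esup (EFin \o u) /\
  limn_esup (EFin \o u) \is a fin_num.
Proof.
split=> [cu|[eq_lim fin_lim]].
  have : (EFin \o u) @ \oo --> (limn u)%:E by apply: cvg_EFin; first exact: nearW.
  by move=> /cvg_limn_einf_sup[-> ->].
apply/cvg_ex; exists (fine (limn_esup (EFin \o u))).
have : (EFin \o u) @ \oo --> (fine (limn_esup (EFin \o u)))%:E.
  rewrite fineK//.
  apply: (@squeeze_cvge _ _ _ _ (einfs (EFin \o u)) _ (esups (EFin \o u))).
  - apply: nearW => k; rewrite /einfs /esups /=.
    apply/andP; split; [apply: ereal_inf_lbound|apply: ereal_sup_ubound];
      by exists k => //=.
  - by rewrite -eq_lim limn_einf_lim; exact: is_cvg_einfs.
  - by rewrite limn_esup_lim; exact: is_cvg_esups.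
by move=> /fine_cvg.
Qed.

Lemma measurable_cvgn f : (forall k, measurable_fun setT (f k)) ->
  measurable [set w | cvgn (f ^~ w)].
Proof.
move=> mf.
have mEf k : measurable_fun setT (EFin \o f k) by exact/measurable_EFinP.
have mi := measurable_fun_limn_einf mEf.
have ms := measurable_fun_limn_esup mEf.
rewrite (_ : [set w | _] =
  (setT `&` [set w | limn_einf (fun k => (EFin \o f k) w) = limn_esup (fun k => (EFin \o f k) w)]) `&`
  (setT `&` [set w | limn_esup (fun k => (EFin \o f k) w) \is a fin_num])); last first.
  by rewrite !setTI; apply/seteqP; split => w /=; rewrite cvgn_limn_einf_esup.
apply: measurableI; first exact: measurable_eqe.
exact: emeasurable_fin_num.
Qed.

(* Where the limit does not exist, [limn] has a constant junk value. *)
Lemma measurable_limn f : (forall k, measurable_fun setT (f k)) ->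
  measurable_fun setT (fun w => limn (f ^~ w)).
Proof.
move=> mf; have mC := measurable_cvgn mf.
rewrite -(setUv [set w | cvgn (f ^~ w)]).
apply/measurable_funU => //; first exact: measurableC.
split; last first.
  apply: (eq_measurable_fun (cst point)); last exact: measurable_cst.
  by move=> w /set_mem/dvgP.
apply/measurable_EFinP.
apply: (@emeasurable_fun_cvg _ _ _ _ (fun k => EFin \o f k)).
  by move=> k; apply/measurable_EFinP; exact: measurable_funTS.
by move=> w cw; apply: cvg_EFin; first exact: nearW.
Qed.

Variable P : probability T R.

(** At points of convergence the power of the limit is at most the lower limit of the powers [u k],
    and by Fatou the integral of the latter is at most [C] to the power [p]. *)
Lemma Lp_limn_le p f (C : \bar R) : (0 < p)%R ->
  (forall k, measurable_fun setT (f k)) -> (forall k, Lp P p (f k) <= C) ->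
  {ae P, forall w, cvgn (f ^~ w)} -> Lp P p (fun w => limn (f ^~ w)) <= C.
Proof.
move=> p0 mf fC cf; have pn0 : p != 0%R by rewrite gt_eqF.
have [->|Coo] := eqVneq C +oo; first exact: leey.
have C0 : 0 <= C by apply: le_trans (fC 0%N); exact: Lp_ge0.
pose u k w := (`|f k w| `^ p)%:E.
have mu k : measurable_fun setT (u k) by exact: measurable_abs_powR.
have u0 k w : 0 <= u k w by rewrite lee_fin powR_ge0.
have Iu k : \int[P]_w u k w <= C `^ p.
  have := fC k; rewrite LpE => h.
  rewrite -[leLHS](@poweRe1 _ _); last exact: integral_ge0.
  rewrite -(mulVf pn0) poweRrM.
  apply: gt0_ler_poweR => //; first exact: ltW.
    by rewrite in_itv/= leey poweR_ge0.
  by rewrite in_itv/= leey C0.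
have einf0 w : 0 <= limn_einf (u ^~ w).
  rewrite limn_einf_lim; apply: lime_ge; first exact: is_cvg_einfs.
  by apply: nearW => k; apply: le_ereal_inf_tmp => _ [j _ <-].
rewrite LpE -[C](@poweRe1 _ _)// -(mulfV pn0) poweRrM.
apply: gt0_ler_poweR; first by rewrite invr_ge0 ltW.
- by rewrite in_itv/= leey andbT integral_ge0// => w _; rewrite lee_fin powR_ge0.
- by rewrite in_itv/= leey andbT poweR_ge0.
apply: (@le_trans _ _ (\int[P]_w limn_einf (u ^~ w))).
  apply: ae_ge0_le_integral => //.
  - exact/measurable_abs_powR/measurable_limn.
  - exact: measurable_fun_limn_einf.
  move: cf; apply: filterS => w cw Tw.
  (* Continuity of the power is drawn from its differentiability on the positive half-line. A zero
     limit is separate: its power is [0], below the nonnegative lower limit. *)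
  have [->|l0] := eqVneq (limn (f ^~ w)) 0%R.
    by rewrite normr0 powR0 ?gt_eqF.
  suff : u ^~ w @ \oo --> (`|limn (f ^~ w)| `^ p)%:E by move=> /cvg_limn_einf_sup[-> _].
  apply: cvg_EFin; first exact: nearW.
  apply: (@cvg_comp _ _ _ (fun k => `|f k w|)%R (@powR R ^~ p) _ (nbhs `|limn (f ^~ w)|%R)).
    exact: cvg_norm.
  suff : {for `|limn (f ^~ w)|%R, continuous (@powR R ^~ p)} by [].
  apply/differentiable_continuous/derivable1_diffP/derivable_powR.
  by rewrite in_itv/= andbT normr_gt0.
apply: (le_trans (fatou _ _ _ _)) => //.
rewrite limn_einf_lim; apply: lime_le; first exact: is_cvg_einfs.
apply: nearW => k; apply: le_trans (Iu k).
by apply: ereal_inf_lbound; exists k => //=.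
Qed.
End limits.

(** * From sums over index tuples to nested sums *)

Section increasing_sequences.
Variable M : nat.

Fixpoint increasing_seqs (k d : nat) : seq (seq nat) :=
  if d is d'.+1 then
    [seq i :: t | i <- index_iota k M.+1, t <- increasing_seqs i.+1 d']
  else [:: [::]].

Lemma mem_increasing_seqs k d (t : seq nat) : (t \in increasing_seqs k d) =
  [&& size t == d, sorted ltn t & all (fun i => k <= i <= M)%N t].
Proof.
elim: d k t => [|d IH] k t /=; first by case: t.
apply/allpairsPdep/idP => [[i [t' [ik t'd ->]]]|].
  move: t'd; rewrite IH => /and3P[/eqP <- st at'] /=; rewrite eqxx/=.
  rewrite (path_sortedE ltn_trans) st andbT.
  move: ik; rewrite mem_index_iota ltnS => /andP[ki iM]; rewrite ki iM/=.
  apply/andP; split; apply/allP => j /(allP at') /andP[ij jM]; first by [].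
  by rewrite jM andbT (leq_trans ki)// ltnW.
case: t => [//|i t] /and3P[/eqP[td] /=].
rewrite (path_sortedE ltn_trans) => /andP[lt_it st] /andP[/andP[ki iM] at'].
exists i, t; split => //; first by rewrite mem_index_iota ki.
rewrite IH td eqxx st/=; apply/allP => j jt.
by have /andP[_ ->] := allP at' _ jt; rewrite andbT; exact: (allP lt_it).
Qed.

Lemma uniq_increasing_seqs k d : uniq (increasing_seqs k d).
Proof.
elim: d k => [//|d IH] k /=; apply: allpairs_uniq_dep => //.
  exact: iota_uniq.
by move=> [i t] [j u] _ _ /= [-> ->].
Qed.

Lemma sqsumE (R : realType) k d (b : seq nat -> R) :
  sqsum M k d b = (\sum_(t <- increasing_seqs k d) b t ^+ 2)%R.
Proof.
elim: d k b => [|d IH] k b /=; first by rewrite big_seq1.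
by rewrite big_allpairs_dep; apply: eq_bigr => i _; rewrite IH.
Qed.

Lemma iter_polyE (R : realType) (T I : Type) (X : I -> nat -> T -> R) k (l : seq I) b w :
  iter_poly M X k l b w = (\sum_(t <- increasing_seqs k (size l))
    b t * \prod_(q <- zip l t) X q.1 q.2 w)%R.
Proof.
elim: l k b => [|m l IH] k b /=; first by rewrite big_seq1 big_nil mulr1.
rewrite big_allpairs_dep; apply: eq_bigr => i _.
rewrite IH big_distrr/=; apply: eq_bigr => t _.
by rewrite big_cons/= mulrCA.
Qed.

Variables (d n : nat).

(** The default tuple of zeros is never reached, since every listed sequence has length [d]. *)
Definition increasing_tuples : seq (d.-tuple nat) :=
  [seq insubd (nseq_tuple d 0%N) t | t <- increasing_seqs n d].

Lemma increasing_tuplesK t : t \in increasing_seqs n d ->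
  val (insubd (nseq_tuple d 0%N) t) = t.
Proof. by rewrite mem_increasing_seqs => /and3P[td _ _]; rewrite insubdK. Qed.

Lemma uniq_increasing_tuples : uniq increasing_tuples.
Proof.
rewrite map_inj_in_uniq ?uniq_increasing_seqs// => t u tM uM tu.
by rewrite -(increasing_tuplesK tM) tu increasing_tuplesK.
Qed.

Lemma multi_indexE : multi_index n (Some M) = [set` increasing_tuples].
Proof.
apply/seteqP; split => [t [st rt]|_ /mapP[t tM ->]].
  have tM : val t \in increasing_seqs n d.
    rewrite mem_increasing_seqs size_tuple eqxx st/=.
    by apply/all_tnthP => i; have [-> ->] := rt i.
  apply/mapP; exists (val t) => //; apply/val_inj.
  by rewrite increasing_tuplesK.
have tE := increasing_tuplesK tM.
move: tM; rewrite mem_increasing_seqs => /and3P[_ st at'].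
split; first by rewrite [tval _]tE.
move=> i; have : tnth (insubd (nseq_tuple d 0%N) t) i \in t by rewrite -[X in _ \in X]tE mem_tnth.
by move=> /(allP at') /andP[].
Qed.

Lemma V_finE (R : realType) (dT : measure_display) (T : measurableType dT)
    (xi : nat -> 'I_d -> T -> R)
    (b : d.-tuple nat -> R) w :
  V_fin n M xi b w = iter_poly M (fun m i => xi i m) n (enum 'I_d)
    (b \o insubd (nseq_tuple d 0%N)) w.
Proof.
rewrite /V_fin multi_indexE -fsbig_seq; last exact: uniq_increasing_tuples.
rewrite iter_polyE size_enum_ord big_map big_seq [RHS]big_seq.
apply: eq_bigr => t /increasing_tuplesK tE; congr (_ * _)%R.
set I := insubd _ _ in tE *.
(* Writing the list as the entries [tnth I m] aligns the product over [zip] with the one over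
   ['I_d]. *)
rewrite -[X in zip _ X]tE -[X in zip _ X]map_tnth_enum.
rewrite -big_enum/=; elim: (enum _) => [|m l IH]; first by rewrite !big_nil.
by rewrite /= !big_cons IH.
Qed.

(** Truncation at [M] keeps finitely many of the nonnegative squares whose total is one. *)
Lemma sqsum_le1 (R : realType) N (b : d.-tuple nat -> R) : unit_arrays n N b ->
  (if N is Some N' then (M <= N')%N else true) ->
  (sqsum M n d (b \o insubd (nseq_tuple d 0%N)) <= 1)%R.
Proof.
move=> b1 MN; rewrite sqsumE -lee_fin -b1.
apply: esum_ge; exists (multi_index n (Some M)).
  split; first by rewrite multi_indexE; exact: finite_seq.
  move=> t [st rt]; split => // m; have [nm mM] := rt m; split => //.
  by case: N b1 MN => [N'|//] _ MN; exact: leq_trans MN.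
rewrite multi_indexE -fsbig_seq; last exact: uniq_increasing_tuples.
by rewrite big_map -sumEFin.
Qed.

End increasing_sequences.

(** The extreme denominators are harmless: [y = 0] forces the quotient [0 / 0 = 0], and division by
    [+oo] gives [0]. *)
Lemma lee_div1 (R : realType) (x y : \bar R) : 0 <= x -> x <= y -> x / y <= 1.
Proof.
move=> x0 xy; have y0 := le_trans x0 xy.
have [y00|yn0] := eqVneq y 0.
  have -> : x = 0 by apply/eqP; rewrite eq_le x0 andbT -y00.
  by rewrite mul0e.
case: y y0 yn0 xy => [y| |//] y0 yn0 xy; last by rewrite invey mule0.
have {}y0 : (0 < y)%R by rewrite -lte_fin lt0e yn0.
by rewrite inver gt_eqF// lee_pdivrMr// mul1e.
Qed.

Lemma prode_ge1 (R : realType) (I : Type) (r : seq I) (f : I -> \bar R) :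
  (forall i, 1 <= f i) -> 1 <= \prod_(i <- r) f i.
Proof.
move=> f1; elim: r => [|i r IH]; first by rewrite big_nil.
by rewrite big_cons -[leLHS]mule1; apply: lee_pmul.
Qed.

(** * Moment bounds for the polynomials *)

Section polynomial_moments.
Context (dT : measure_display) (T : measurableType dT) (R : realType).
Variable P : probability T R.

(** One exponent [p] in [(2, r)] suffices: there [nu p] is positive and finite, and moments divided
    by their own supremum have supremum at least one. *)
Lemma Gnorm_seq_moment_sup_ge1 (J : set nat) (r : \bar R) (X : nat -> T -> R) :
  2%:E < r -> Gclass r (moment_sup P J X) ->
  1 <= Gnorm_seq P J r (moment_sup P J X) X.
Proof.
move=> r2 [_ nufin _ _]; set nu := moment_sup P J X in nufin *.
have [p /andP[p2 pr]] : exists p : R, 2%:E < p%:E < r.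
  case: r r2 {nufin} => [r| |//]; last by exists 3%R; rewrite lte_fin ltry andbT; lra.
  by rewrite lte_fin => r2; exists ((2 + r) / 2)%R; rewrite !lte_fin; lra.
have /nufin/andP[nu0 nuoo] : 1 <= p%:E < r.
  by rewrite pr andbT lee_fin; move: p2; rewrite lte_fin; lra.
set S := esup0 [set Lp P p (X i) / nu p | i in J].
apply: (@le_trans _ _ S); last by apply: esup0_ubound; exists p => //=; rewrite p2.
have S0 : 0 <= S := esup0_ge0 _.
have nuS : nu p <= S * nu p.
  apply: esup0_le; first by rewrite mule_ge0// ltW.
  move=> _ [i Ji <-].
  have : Lp P p (X i) / nu p <= S by apply: esup0_ubound; exists i.
  case: (nu p) nu0 nuoo => [y| |]//; rewrite lte_fin => y0 _.
  by rewrite inver gt_eqF// lee_pdivrMr.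
case: (nu p) nu0 nuoo nuS => [y| |]//; rewrite lte_fin => y0 _.
by rewrite -lee_pdivrMr// -EFinM divff// gt_eqF.
Qed.

(* Beyond M the inner sums are constant, so the trivial sigma-algebra extends the
   filtration and removes the boundary case i = M. *)
Definition extend_filtration (M : nat) (F : nat -> set (set T)) (k : nat) :=
  if (k <= M)%N then F k else [set set0; setT].

Lemma trivial_sub_sigma_algebra :
  Defs.sub_sigma_algebra ([set set0; setT] : set (set T)).
Proof.
split; last by move=> A [] ->.
split=> [|A [] ->|A hA]; first by left.
- by right; rewrite setD0.
- by left; rewrite setDv.
have [[i Ai]|noA] := pselect (exists i, A i = setT).
  by right; apply/seteqP; split => // w _; exists i => //; rewrite Ai.
left; rewrite bigcup0// => i _.
by have [//|Ai] := hA i; case: noA; exists i.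
Qed.

Variables (d n : nat) (N : option nat) (F : nat -> set (set T)).
Variables (xi : nat -> 'I_d -> T -> R) (rr : 'I_d -> \bar R).
Let J := index_range n N.
Let nu (m : 'I_d) := moment_sup P J (fun i => xi i m).
Hypothesis filtF : reverse_filtration J F.
Hypothesis mdxi : forall m : 'I_d, reverse_martingale_differences P J F (fun i => xi i m).
Hypothesis nuG : forall m : 'I_d, 2%:E < rr m /\ Gclass (rr m) (nu m).
Hypothesis r_gt1 : 1 < (\sum_(m < d) (rr m)^-1)^-1.

Let s m : R := fine (rr m)^-1.

Let sE m : (rr m)^-1 = (s m)%:E.
Proof.
have [r2 _] := nuG m; rewrite /s.
case: (rr m) r2 => [r|_|//]; last by rewrite !invey.
by rewrite lte_fin => r2; rewrite !inver gt_eqF// (lt_trans _ r2).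
Qed.

Let s_ge0 m : (0 <= s m)%R.
Proof.
rewrite -lee_fin -sE; have [r2 _] := nuG m.
by rewrite inve_ge0 (le_trans _ (ltW r2)).
Qed.

(** This is [1 < r] inverted. A zero sum, where all [rr m] are infinite and [r = 1/0 = +oo], is
    treated apart. *)
Let sum_s_lt1 : (\sum_(m <- enum 'I_d) s m < 1)%R.
Proof.
rewrite big_enum/=; move: r_gt1.
rewrite (eq_bigr (fun m => (s m)%:E)); last by move=> m _; exact: sE.
rewrite sumEFin; set S := (\sum_(m < d) s m)%R => S1.
have [->//|S0] := eqVneq S 0%R.
have {}S0 : (0 < S)%R by rewrite lt0r S0 sumr_ge0.
by move: S1; rewrite inver gt_eqF// lte_fin invf_gt1.
Qed.

Lemma V_fin_Lp_le M (b : d.-tuple nat -> R) (p : R) : (0 < d)%N -> (1 <= p)%R ->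
  (if N is Some N' then (M <= N')%N else true) -> unit_arrays n N b ->
  Lp P p (V_fin n M xi b) <= zeta [seq nu m | m <- enum 'I_d] p.
Proof.
move=> d0 p1 MN b1.
have inJ i : (n <= i <= M)%N -> J i.
  move=> /andP[ni iM]; split => //.
  by case: N MN => // N' MN; exact: leq_trans MN.
have mX m i : (n <= i <= M)%N -> measurable_fun setT (xi i m).
  move=> /inJ /(mdxi m) [_ iX _ _].
  exact/measurable_EFinP/(measurable_int _ iX).
rewrite (_ : V_fin n M xi b = iter_poly M (fun m i => xi i m) n (enum 'I_d)
    (b \o insubd (nseq_tuple d 0%N))); last by apply/funext => w; exact: V_finE.
apply: (@iter_poly_Lp_le _ _ _ P _ _ n M (extend_filtration M F) _ _ _ _ s) => //.
- move=> k nk; rewrite /extend_filtration; case: ifPn => kM.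
    by have [sF _] := filtF; apply: sF; apply: inJ; rewrite nk.
  exact: trivial_sub_sigma_algebra.
- move=> k nk; rewrite /extend_filtration; case: ifPn => kM.
    rewrite (ltnW kM); have [_ dF] := filtF; apply: dF; apply: inJ.
      by rewrite nk ltnW.
    by rewrite kM leqW.
  case: ifPn => kM'; last exact: subset_refl.
  have [sF _] := filtF.
  have [|[F0 FC _] _] := sF k; first by apply: inJ; rewrite nk.
  by move=> A [] ->; [exact: F0|rewrite -(setD0 setT); exact: FC].
- move=> m i niM; have [mi _ _ _] := mdxi m (inJ _ niM).
  by rewrite /extend_filtration; case/andP: niM => _ ->.
- move=> m i k A niM ik; have [_ _ Exi cond0] := mdxi m (inJ _ niM).
  rewrite /extend_filtration; case: ifPn => kM.
    have /cond0/(_ ik)[_ _ h] : J k.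
      by apply: inJ; rewrite kM (leq_trans _ (ltnW ik))//; case/andP: niM.
    by move=> /h <-; rewrite integral0.
  (* Past [M] only the empty set and the whole space remain, and the latter is the centering of
     [xi i m]. *)
  move=> [] ->; first by rewrite integral_set0.
  by move: Exi; rewrite unlock.
- move=> m i niM; split; first exact: mX.
  (* Since [q * s m < 1] means [q < rr m], finiteness comes from membership of [nu m] in
     [Gclass (rr m)]. *)
  move=> q q1 qs; apply: (@le_lt_trans _ _ (nu m q)).
    by apply: esup0_ubound; exists i => //; exact: inJ.
  have [r2 [_ nufin _ _]] := nuG m.
  suff qr : 1 <= q%:E < rr m by have /andP[] := nufin _ qr.
  rewrite lee_fin q1/=; move: qs; rewrite /s.
  case: (rr m) r2 => [r| |]//; last by move=> _ _; rewrite ltry.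
  rewrite !lte_fin => r2; have r0 : (0 < r)%R by lra.
  by rewrite inver gt_eqF//= ltr_pdivrMr// mul1r.
- by move=> m i q niM; apply: esup0_ubound; exists i => //; exact: inJ.
- by move=> m q; exact: esup0_ge0.
- by rewrite size_enum_ord.
- by rewrite size_enum_ord; exact: sqsum_le1 MN.
Qed.

Lemma V_fin_measurable M b : (if N is Some N' then (M <= N')%N else true) ->
  measurable_fun setT (V_fin n M xi b).
Proof.
move=> MN.
rewrite (_ : V_fin n M xi b = fun w => \sum_(I <- increasing_tuples M d n)
    b I * \prod_(m < d) xi (tnth I m) m w)%R; last first.
  apply/funext => w.
  by rewrite /V_fin multi_indexE -fsbig_seq//; exact: uniq_increasing_tuples.
apply: measurable_sum_in => I IM; apply: measurable_funM => //.
apply: measurable_prod => m _.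
have : multi_index n (Some M) I by rewrite multi_indexE.
move=> [_ /(_ m)[nI IM']].
have [|_ iX _ _] := mdxi m (i := tnth I m).
  by split => //; case: N MN => // N' MN; exact: leq_trans MN.
exact/measurable_EFinP/(measurable_int _ iX).
Qed.

(** A finite [N] is itself a truncation level; for infinite [N] the bound is uniform in [M] and
    survives the almost sure limit. *)
Lemma V_Lp_le (b : d.-tuple nat -> R) (p : R) : (0 < d)%N -> (1 <= p)%R ->
  unit_arrays n N b -> V_exists P n N xi b ->
  Lp P p (V n N xi b) <= zeta [seq nu m | m <- enum 'I_d] p.
Proof.
move=> d0 p1 b1; rewrite /V_exists /V.
move: V_fin_Lp_le V_fin_measurable b1; rewrite /nu /J.
case: N => [M|] VL Vm b1; first by move=> _; exact: VL.
move=> cv; apply: Lp_limn_le => //.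
- exact: lt_le_trans p1.
- by move=> M; exact: Vm.
- by move=> M; exact: VL.
Qed.

End polynomial_moments.

Theorem theorem7p1 (R : realType) (dT : measure_display)
    (T : measurableType dT) (P : probability T R)
    (d n : nat) (N : option nat)
    (F : nat -> set (set T)) (xi : nat -> 'I_d -> T -> R)
    (rr : 'I_d -> \bar R)
    (d_ge1 : (1 <= d)%N) (n_ge1 : (1 <= n)%N)
    (n_leN : if N is Some M then (n <= M)%N else true)
    (filtF : reverse_filtration (index_range n N) F)
    (mdxi : forall m : 'I_d,
      reverse_martingale_differences P (index_range n N) F
        (fun i => xi i m)) :
  let nu (m : 'I_d) : R -> \bar R :=
    moment_sup P (index_range n N) (fun i => xi i m) in
  let zeta1 : R -> \bar R := zeta [seq nu m | m <- enum 'I_d] in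
  let r : \bar R := (\sum_(m < d) (rr m)^-1)^-1 in
  (forall m : 'I_d, 2%:E < rr m /\ Gclass (rr m) (nu m)) ->
  1 < r ->
  esup0 [set Gnorm P r zeta1 (V n N xi b)
        | b in [set b | unit_arrays n N b /\ V_exists P n N xi b]] <=
  \prod_(m < d)
    Gnorm_seq P (index_range n N) (rr m) (nu m) (fun i => xi i m).
Proof.
move=> nu zeta1 r nuG r1.
(* The value [1] separates the two sides: every factor on the right is at least one, every ratio on
   the left at most one. *)
apply: (@le_trans _ _ 1); last first.
  by apply: prode_ge1 => m; apply: Gnorm_seq_moment_sup_ge1; case: (nuG m).
apply: esup0_le => // _ [b [b1 bV] <-].
apply: esup0_le => // _ [p /andP[p2 _] <-].
apply: lee_div1; first exact: Lp_ge0.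
apply: (V_Lp_le filtF mdxi nuG r1 d_ge1 _ b1 bV).
by move: p2; rewrite lte_fin; lra.
Qed.
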